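(* Every strongly NUS-nil clean ring is strongly $\pi$-regular.
   Context: All rings are associative with identity, not necessarily commutative. An element $e\in R$ is square-idempotent if $e^2=e^4$. An element $a\in R$ is strongly square-nil clean if $a=e+n$ with $e\in R$ square-idempotent, $n\in R$ nilpotent and $en=ne$. A ring $R$ is strongly NUS-nil clean if every non-invertible element of $R$ is strongly square-nil clean. A ring $R$ is strongly $\pi$-regular if for every $a\in R$ there exists a positive integer $n$ such that $a^n\in a^{n+1}R$. *)

(* Defs.v *)
From mathcomp Require Import all_boot all_order all_algebra.
Set Implicit Arguments.
Unset Strict Implicit.
Unset Printing Implicit Defensive.
Import GRing.Theory.
Local Open Scope ring_scope.

(* Rings are pzRingType: associative, unital, not necessarily commutative, and
   possibly zero.  Invertibility is spelled out because unitRingType would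
   exclude the zero ring and require a boolean decision of being a unit. *)
Definition invertible (R : pzRingType) (a : R) : Prop :=
  exists b : R, a * b = 1 /\ b * a = 1.

Definition nilpotent_elt (R : pzRingType) (a : R) : Prop :=
  exists n : nat, (0 < n)%N /\ a ^+ n = 0.

Definition square_idempotent (R : pzRingType) (e : R) : Prop :=
  e ^+ 2 = e ^+ 4.

Definition strongly_square_nil_clean (R : pzRingType) (a : R) : Prop :=
  exists e n : R,
    [/\ a = e + n, square_idempotent e, nilpotent_elt n & e * n = n * e].

Definition strongly_NUS_nil_clean (R : pzRingType) : Prop :=
  forall a : R, ~ invertible a -> strongly_square_nil_clean a.

Definition strongly_pi_regular (R : pzRingType) : Prop :=
  forall a : R, exists n : nat,
    (0 < n)%N /\ exists r : R, a ^+ n = a ^+ n.+1 * r.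

(* Main.v *)
Require Import Defs.
From mathcomp Require Import all_boot all_order all_algebra.
From Stdlib Require Import Classical.

(** An invertible [a] satisfies [a = a^2 * a^-1], so only the non-invertible
    elements matter, and these are strongly square-nil clean: [a = e + n].
    Square-idempotents are the roots of [x^2 - x^4]; as [e] and [n] commute,
    [a^2 - a^4] differs from [e^2 - e^4 = 0] by a multiple of [n], hence is
    nilpotent ([square_nil_clean_sub_nilpotent]).  If [(a^2 - a^4)^m = 0], then
    [a^(2m) * (1 - a^2)^m = 0]; expanding the second factor as
    [1 - a * (a * s)] gives [a^(2m) = a^(2m+1) * (a * s)]
    ([sub_nilpotent_pi_regular]). *)

Set Implicit Arguments.
Unset Strict Implicit.
Unset Printing Implicit Defensive.
Import GRing.Theory.
Local Open Scope ring_scope.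

Lemma nilpotent_mul_comm (R : pzRingType) (x y : R) :
  GRing.comm x y -> nilpotent_elt x -> nilpotent_elt (x * y).
Proof.
by move=> cxy [m [m_gt0 xm0]]; exists m; rewrite exprMn_comm // xm0 mul0r.
Qed.

(** With [p(x) = x^2 - x^4], commutation of [a] and [e] gives
    [p(a) - p(e) = (a - e) * (a + e) * (1 - (a^2 + e^2))]: the factor [a - e]
    is the nilpotent part of [a], and it commutes with the rest. *)
Lemma square_nil_clean_sub_nilpotent (R : pzRingType) (a : R) :
  strongly_square_nil_clean a -> nilpotent_elt (a ^+ 2 - a ^+ 4).
Proof.
move=> [e [n [def_a e2e4 nil_n cen]]].
have cne : GRing.comm n e by [].
have cna : GRing.comm n a by rewrite def_a; apply: commrD.
have cae : GRing.comm a e by rewrite /GRing.comm def_a mulrDl mulrDr cen.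
have cae2 : GRing.comm (a ^+ 2) (e ^+ 2).
  by apply: commrX; apply/commr_sym/commrX/commr_sym.
have diff2 : a ^+ 2 - e ^+ 2 = n * (a + e).
  by rewrite subrXX_comm // !big_ord_recr big_ord0 /= !expr0 !expr1 add0r
             mulr1 mul1r def_a addrAC subrr add0r.
have diff4 : a ^+ 4 - e ^+ 4 = n * (a + e) * (a ^+ 2 + e ^+ 2).
  rewrite -[4%N]/(2 * 2)%N !exprM subrXX_comm // diff2.
  by rewrite !big_ord_recr big_ord0 /= !expr0 !expr1 add0r mulr1 mul1r.
have -> : a ^+ 2 - a ^+ 4 = n * ((a + e) * (1 - (a ^+ 2 + e ^+ 2))).
  rewrite mulrA mulrBr mulr1 -diff4 -diff2 -e2e4.
  by rewrite opprB addrA subrK.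
apply: nilpotent_mul_comm => //.
apply: commrM; first exact: commrD.
by apply: commrB; [exact: commr1 | apply: commrD; exact: commrX].
Qed.

Lemma sub_nilpotent_pi_regular (R : pzRingType) (a : R) :
  nilpotent_elt (a ^+ 2 - a ^+ 4) ->
  exists n : nat, (0 < n)%N /\ exists r : R, a ^+ n = a ^+ n.+1 * r.
Proof.
move=> [m [m_gt0 pm0]]; exists (2 * m)%N; split; first by rewrite muln_gt0.
have prod0 : a ^+ (2 * m) * (1 - a ^+ 2) ^+ m = 0.
  rewrite exprM -exprMn_comm ?mulrBr ?mulr1 -?exprD //.
  by apply: commrB; [exact: commr1 | exact: commr_refl].
(* The geometric sum for [1^m - (1 - a^2)^m] has the factor [a^2]. *)
have [s expand] : exists s, 1 - (1 - a ^+ 2) ^+ m = a ^+ 2 * s.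
  rewrite -[X in X - _](expr1n R m) subrXX_comm; last exact/commr_sym/commr1.
  by rewrite opprB addrC subrK; eexists.
exists (a * s).
rewrite exprSr -mulrA (mulrA a a s) -expr2 -expand mulrBr mulr1 prod0.
by rewrite subr0.
Qed.

Theorem proposition2p7 (R : pzRingType) :
  strongly_NUS_nil_clean R -> strongly_pi_regular R.
Proof.
move=> nusR a; have [[b [ab1 _]]|a_ninv] := classic (invertible a).
  by exists 1%N; split=> //; exists b; rewrite expr2 -mulrA ab1 mulr1.
exact/sub_nilpotent_pi_regular/square_nil_clean_sub_nilpotent/nusR.
Qed.
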